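(* Let $R$ be a commutative ring with unit and $M$ an $R$-module, and assume one of: (a) $R$ is an integral domain and $M$ is a torsion-free $R$-module; (b) $R$ is a Dedekind domain; (c) $R$ is a reduced ring with finitely many minimal prime ideals and $M=R$. Let $\mathbf A$ be a $k\times l$ matrix with entries in $R$ and let $\mathbf b\in M^k$ be nonzero. Then the equation $\mathbf A\mathbf m=\mathbf b$ is partition regular over $M$ if and only if it has a constant solution in $M$, i.e. there is $m\in M$ with $\mathbf A(m,\dots,m)^{\intercal}=\mathbf b$.
   Context: The equation $\mathbf{A}\mathbf{m}=\mathbf b$ is partition regular over $M$ if for every $r\ge1$ and every map $\chi\colon M\to\{1,\dots,r\}$ there exists $\mathbf m=(m_1,\dots,m_l)^{\intercal}\in M^l$, not all $m_i$ zero, with $\mathbf{A}\mathbf{m}=\mathbf b$ and $\chi(m_1)=\dots=\chi(m_l)$. *)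

(* Defs.v *)
From HB Require Import structures.
From mathcomp Require Import all_boot all_order all_algebra.
From mathcomp Require Import fraction.
Set Implicit Arguments. Unset Strict Implicit. Unset Printing Implicit Defensive.
Import Order.TTheory GRing.Theory Num.Theory.
Local Open Scope ring_scope.

Definition is_ideal (R : comNzRingType) (I : R -> Prop) : Prop :=
  [/\ I 0, (forall x y, I x -> I y -> I (x + y)) & (forall a x, I x -> I (a * x))].

Definition is_prime_ideal (R : comNzRingType) (P : R -> Prop) : Prop :=
  [/\ is_ideal P, ~ P 1 & (forall x y, P (x * y) -> P x \/ P y)].

Definition is_maximal_ideal (R : comNzRingType) (P : R -> Prop) : Prop :=
  [/\ is_ideal P, ~ P 1 &
      (forall J : R -> Prop, is_ideal J -> (forall x, P x -> J x) ->
         (forall x, J x -> P x) \/ J 1)].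

Definition is_minimal_prime (R : comNzRingType) (P : R -> Prop) : Prop :=
  is_prime_ideal P /\
  (forall Q : R -> Prop, is_prime_ideal Q -> (forall x, Q x -> P x) ->
     forall x, P x -> Q x).

Definition finitely_many_minimal_primes (R : comNzRingType) : Prop :=
  exists (n : nat) (f : 'I_n -> (R -> Prop)),
    forall P : R -> Prop, is_minimal_prime P -> exists i, forall x, P x <-> f i x.

Definition reduced_ring (R : comNzRingType) : Prop :=
  forall (x : R) (n : nat), x ^+ n = 0 -> x = 0.

Definition noetherian_ring (R : comNzRingType) : Prop :=
  forall I : nat -> (R -> Prop), (forall n, is_ideal (I n)) ->
    (forall n x, I n x -> I n.+1 x) ->
    exists N, forall n, (N <= n)%N -> forall x, I n x -> I N x.

Definition integrally_closed (R : idomainType) : Prop :=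
  forall x : {fraction R},
    (exists p : {poly R}, p \is monic /\ root (map_poly (@tofrac R) p) x) ->
    exists a : R, x = tofrac a.

Definition dim_le1 (R : comNzRingType) : Prop :=
  forall P : R -> Prop, is_prime_ideal P -> (exists x, P x /\ x <> 0) ->
    is_maximal_ideal P.

Definition dedekind_domain (R : idomainType) : Prop :=
  [/\ noetherian_ring R, integrally_closed R & dim_le1 R].

Definition torsion_free (R : comNzRingType) (M : lmodType R) : Prop :=
  forall (a : R) (x : M), a *: x = 0 -> a = 0 \/ x = 0.

Definition is_solution (R : comNzRingType) (M : lmodType R) (k l : nat)
    (A : 'M[R]_(k, l)) (b : 'I_k -> M) (m : 'I_l -> M) : Prop :=
  forall i : 'I_k, \sum_(j < l) A i j *: m j = b i.

Definition partition_regular (R : comNzRingType) (M : lmodType R) (k l : nat)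
    (A : 'M[R]_(k, l)) (b : 'I_k -> M) : Prop :=
  forall (r : nat), (0 < r)%N -> forall chi : M -> 'I_r,
    exists m : 'I_l -> M,
      [/\ is_solution A b m, (exists j, m j != 0) &
          (forall j j', chi (m j) = chi (m j'))].

Definition has_constant_solution (R : comNzRingType) (M : lmodType R) (k l : nat)
    (A : 'M[R]_(k, l)) (b : 'I_k -> M) : Prop :=
  exists m : M, is_solution A b (fun _ => m).

Definition PR_iff_constant (R : comNzRingType) (M : lmodType R) : Prop :=
  forall (k l : nat) (A : 'M[R]_(k, l)) (b : 'I_k -> M),
    (exists i, b i != 0) ->
    (partition_regular A b <-> has_constant_solution A b).

(* Main.v *)
(** Suppose [A(m,...,m) = b] has no solution, and let [s] be the sum of the columns
    [A_j] of [A].  As [b] is not in the subgroup [s M] of [M^k] and [Q/Z] is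
    divisible, some character [f : M^k -> Q/Z] kills [s M] but not [b].  As in
    Straus' theorem, colour [x] by approximations of all [f(A_j x)].  For a
    monochromatic solution [m], the value [f(b) = \sum_j f(A_j m_j)] would be close
    to [\sum_j f(A_j m_0) = f(s m_0) = 0], whereas [f(b)] is a fixed nonzero
    element of [Q/Z]. *)
Require Import Defs.
From mathcomp Require Import all_boot all_order all_algebra.
From mathcomp Require boolp classical_sets.
From mathcomp Require Import ring lra.
Import Order.TTheory GRing.Theory Num.Theory.
Local Open Scope ring_scope.

(** * Extension of characters with values in Q/Z *)

(* Graphs of homomorphisms from a subgroup of [V] to [Q/Z], seen as subgroups of
   [V * Q]. *)
Definition character_graph (V : zmodType) (H : V * rat -> Prop) : Prop :=
  (forall x y s t, H (x, s) -> H (y, t) -> H (x - y, s - t)) /\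
  (forall q, H (0, q) <-> q \is a Num.int).

Section CharacterGraph.
Variables (V : zmodType) (H : V * rat -> Prop).
Hypothesis gH : character_graph V H.

Lemma graphB x y s t : H (x, s) -> H (y, t) -> H (x - y, s - t).
Proof. exact: (proj1 gH). Qed.

Lemma graph0 q : H (0, q) <-> q \is a Num.int.
Proof. exact: (proj2 gH). Qed.

Lemma graphN x s : H (x, s) -> H (- x, - s).
Proof. by move=> Hx; rewrite -[- x]sub0r -[- s]sub0r; apply: graphB; rewrite ?graph0. Qed.

Lemma graphD x y s t : H (x, s) -> H (y, t) -> H (x + y, s + t).
Proof. by move=> Hx /graphN Hy; rewrite -[y]opprK -[t]opprK; apply: graphB. Qed.

Lemma graphMz x s (n : int) : H (x, s) -> H (x *~ n, s *~ n).
Proof.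
move=> Hx.
have Hn (p : nat) : H (x *~ p, s *~ p).
  by elim: p => [|p IHp]; rewrite ?graph0 // -addn1 PoszD !mulrzDr; apply: graphD.
by case: n => p; rewrite ?NegzE ?mulrNz; [|apply: graphN]; apply: Hn.
Qed.

Definition adjoin x q (u : V * rat) : Prop :=
  exists n : int, H (u.1 - x *~ n, u.2 - q *~ n).

Lemma adjoin_sub x q u : H u -> adjoin x q u.
Proof. by case: u => y s Hu; exists 0; rewrite /= !mulr0z !subr0. Qed.

Lemma adjoin_mem x q : adjoin x q (x, q).
Proof. by exists 1; rewrite /= !mulr1z !subrr graph0. Qed.

(** Compatibility keeps the fibre over 0 integral: if [(0, t)] is adjoined using [n] copies of
    [(x, q)], then [H] contains [(x *~ n, q *~ n - t)], and [compat] makes [t] an integer. *)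
Lemma adjoin_graph x q :
    (forall (n : int) t, H (x *~ n, t) -> q *~ n - t \is a Num.int) ->
  character_graph V (adjoin x q).
Proof.
move=> compat; split=> [y z s t [n Hy] [p Hz] | t].
  exists (n - p); rewrite /= !mulrzBr.
  by rewrite !opprD addrACA [s - t + _]addrACA -!opprD; apply: graphB.
split=> [[n /=]|/graph0]; last exact: adjoin_sub.
rewrite sub0r => /graphN; rewrite opprK opprB => /compat.
by rewrite opprB addrC subrK.
Qed.

(* If [x *~ d] is the least positive multiple of [x] in the domain, with value [t],
   both [t / d] and [(t + 1) / d] are admissible, and they are not both integers. *)
Lemma adjoin_value x : (forall t, ~ H (x, t)) ->
  exists2 q : rat, q \isn't a Num.int &
    forall (n : int) t, H (x *~ n, t) -> q *~ n - t \is a Num.int.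
Proof.
move=> xnH.
have [[d0 Hd0]|noH] := boolp.pselect (exists d : nat, exists t, H (x *~ d.+1, t)); last first.
  (* No nonzero multiple of [x] has a value, so any non-integer is admissible. *)
  exists 2^-1; first by [].
  case=> [[|d]|d] t Ht.
  - by move: Ht; rewrite !mulr0z sub0r graph0 rpredN.
  - by case: noH; exists d, t.
  - by case: noH; exists d, (- t); move/graphN: Ht; rewrite NegzE mulrNz opprK.
pose P d := boolp.asbool (exists t, H (x *~ d.+1, t)).
have exP : exists d, P d by exists d0; apply/boolp.asboolP.
case: (ex_minnP exP) => d /boolp.asboolP[t Ht] min_d.
(* The least multiple is [d.+1]; it is at least 2 because [x] itself has no value, so [1 / D] is not
   an integer. *)
have d_gt0 : (0 < d)%N.
  by rewrite lt0n; apply/eqP => d0E; apply: (xnH t); move: Ht; rewrite d0E mulr1z.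
pose D : rat := d.+1%:R.
have D_neq0 : D != 0 by rewrite pnatr_eq0.
(* Only the multiple [d.+1] has to be checked: after division of [n] by [d.+1], minimality forces
   the remainder to be 0. *)
have good q : H (x *~ d.+1, q *~ d.+1) ->
    forall (n : int) u, H (x *~ n, u) -> q *~ n - u \is a Num.int.
  move=> Hq n u Hn.
  have Hr := graphB _ _ _ _ Hn (graphMz _ _ (n %/ d.+1)%Z Hq).
  rewrite -!mulrzA -mulrzBr in Hr.
  have nE : n = ((n %/ d.+1)%Z * d.+1 + (n %% d.+1)%Z) by exact: divz_eq.
  have rE : n - d.+1%:Z * (n %/ d.+1)%Z = (n %% d.+1)%Z.
    by rewrite {1}nE mulrC addrC addKr.
  rewrite rE in Hr.
  have r_ge0 : 0 <= (n %% d.+1)%Z by exact: modz_ge0.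
  have r_lt : (n %% d.+1)%Z < d.+1 by exact: ltz_pmod.
  move: nE Hr r_ge0 r_lt; case: (n %% d.+1)%Z => [[|r]|//] nE Hr _ r_lt.
    move: Hr; rewrite mulr0z graph0 -rpredN opprB.
    by rewrite {2}nE addr0 [_ * d.+1%:Z]mulrC.
  have : P r by apply/boolp.asboolP; eexists; exact: Hr.
  by move/min_d; rewrite leqNgt; case/negP; move: r_lt; rewrite ltz_nat ltnS.
have scale (v : rat) : (v / D) *~ d.+1 = v by rewrite -pmulrn -mulr_natr divfK.
have [tDint|tDnint] := boolP (t / D \is a Num.int); last first.
  by exists (t / D) => //; apply: good; rewrite scale.
exists ((t + 1) / D); last first.
  apply: good; rewrite scale -[x *~ _]addr0; apply: graphD => //.
  exact/graph0.
apply/negP; rewrite mulrDl rpredDl // mul1r.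
by rewrite Qint_def -[D]/(d.+1%:Z%:~R) denqVz // ger0_norm // eqz_nat eqSS -leqn0 leqNgt d_gt0.
Qed.

End CharacterGraph.

Lemma graph_bigcup (V : zmodType) (F : (V * rat -> Prop) -> Prop) :
    (exists X, F X) -> (forall X, F X -> character_graph V X) ->
    (forall X Y, F X -> F Y -> (forall u, X u -> Y u) \/ (forall u, Y u -> X u)) ->
  character_graph V (fun u => exists2 X, F X & X u).
Proof.
move=> [X0 FX0] gF totF; split=> [x y s t [X FX Xx] [Y FY Yy]|q].
  have [XY|YX] := totF X Y FX FY.
    by exists Y => //; apply: (graphB _ _ (gF Y FY)) => //; apply: XY.
  by exists X => //; apply: (graphB _ _ (gF X FX)) => //; apply: YX.
split=> [[X FX]|qint]; first by rewrite (graph0 _ _ (gF X FX)).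
by exists X0; rewrite ?(graph0 _ _ (gF X0 FX0)).
Qed.

(** Zorn's lemma gives a maximal extension; at a point without value, [adjoin_value] and
    [adjoin_graph] would enlarge it. *)
Lemma graph_total_extension (V : zmodType) (H : V * rat -> Prop) :
    character_graph V H ->
  exists H', [/\ character_graph V H', forall u, H u -> H' u & forall x, exists t, H' (x, t)].
Proof.
move=> gH.
(* The empty set is allowed because [Zorn_bigcup] includes the empty chain. *)
pose P (X : classical_sets.set (V * rat)) :=
  (forall u, ~ X u) \/ (character_graph V X /\ forall u, H u -> X u).
have [F FP totF|A [PA maxA]] := @classical_sets.Zorn_bigcup _ P.
  have [[X FX [u Xu]]|noX] :=
    boolp.pselect (exists2 X, F X & exists u, X u); last first.
    by left=> u [X FX Xu]; apply: noX; exists X => //; exists u.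
  (* Dropping the empty members of the chain keeps its union and leaves only graphs. *)
  pose G Y := F Y /\ exists v, Y v.
  have GP Y : G Y -> character_graph V Y /\ forall u, H u -> Y u.
    by case=> /FP[Y0 [v /Y0]|//].
  have GX : G X by split=> //; exists u.
  have gG : character_graph V (fun u => exists2 Y, G Y & Y u).
    apply: graph_bigcup; first by exists X.
      by move=> Y /GP[].
    by move=> Y Z [FY _] [FZ _]; apply: totF.
  suff -> : classical_sets.bigcup F id = (fun u => exists2 Y, G Y & Y u).
    by right; split=> // v Hv; exists X => //; apply: (proj2 (GP _ GX)).
  apply: boolp.funext => v; apply: boolp.propext; split=> [[Y FY Yv]|[Y [FY _] Yv]].
    by exists Y => //; split=> //; exists v.
  by exists Y.
case: PA => [A0|[gA HA]].
  exfalso; apply: (maxA H); last by right.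
  split=> [u /A0 //|HA].
  by apply: (A0 (0, 0)); apply: HA; apply/(graph0 _ _ gH).
exists A; split=> // x; apply: boolp.contrapT => noA.
have [|q _ compat] := adjoin_value _ _ gA x.
  by move=> t At; apply: noA; exists t.
apply: (maxA (adjoin V A x q)); last first.
  by right; split; [exact: adjoin_graph|move=> u /HA; exact: adjoin_sub].
split=> [u|sub]; first exact: adjoin_sub.
by apply: noA; exists q; apply: sub; apply: adjoin_mem.
Qed.

(** Start from the zero character on [S], give [b] a non-integral value and extend to [V]. As [f]
    picks rational representatives, it is additive only modulo integers. *)
Lemma separating_character (V : zmodType) (S : V -> Prop) (b : V) :
    S 0 -> (forall x y, S x -> S y -> S (x - y)) -> ~ S b ->
  exists f : V -> rat,
    [/\ forall x y, f (x + y) - (f x + f y) \is a Num.int,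
        forall x, S x -> f x \is a Num.int & f b \isn't a Num.int].
Proof.
move=> S0 SB Sb.
pose H (u : V * rat) := S u.1 /\ u.2 \is a Num.int.
have gH : character_graph V H.
  split=> [x y s t [Sx si] [Sy ti]|q]; last by split=> [[]|].
  by split; [apply: SB|apply: rpredB].
have [|q qnint compat] := adjoin_value _ _ gH b; first by move=> t [].
have [H' [gH' sub tot]] := graph_total_extension _ _ (adjoin_graph _ _ gH _ _ compat).
have [f Hf] := boolp.choice tot.
have uniq x s t : H' (x, s) -> H' (x, t) -> s - t \is a Num.int.
  by move=> Hs Ht; apply/(graph0 _ _ gH'); rewrite -(subrr x); apply: (graphB _ _ gH').
exists f; split=> [x y|x Sx|].
- by apply: (uniq (x + y)) => //; apply: (graphD _ _ gH').
- rewrite -[f x]subr0; apply: (uniq x) => //.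
  by apply: sub; apply: adjoin_sub.
- apply: contra qnint => fbint; rewrite -[q](subrK (f b)) rpredDr //.
  by apply: (uniq b) => //; apply: sub; apply: adjoin_mem.
Qed.

(** * Colouring by approximate values *)

Section Colouring.
Variables (T : Type) (l : nat) (g : 'I_l -> T -> rat) (L : nat).

(** The circle Q/Z is cut into [L.+1] equal arcs; the colour records, for each [j], the arc that
    contains the class of [g j x]. *)
Definition approximation (x : T) : {ffun 'I_l -> 'I_L.+1} :=
  [ffun j => inord `|(Num.floor (L.+1%:R * g j x) %% L.+1)%Z|].

Lemma approximationP x y j : approximation x = approximation y ->
  exists n : int, L.+1%:R * `|g j x - g j y - n%:~R| < 1.
Proof.
move=> /ffunP/(_ j); rewrite !ffunE => /(congr1 val).
set a : rat := L.+1%:R * g j x; set c : rat := L.+1%:R * g j y.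
have absK (z : int) : `|(z %% L.+1)%Z|%N = (z %% L.+1)%Z :> int.
  by rewrite gez0_abs // modz_ge0.
have small (z : int) : (`|(z %% L.+1)%Z| < L.+1)%N.
  by rewrite -ltz_nat absK ltz_pmod.
rewrite /= !inordK // => /(congr1 Posz); rewrite !absK => modE.
(* Floors with equal remainders differ by a multiple of [L.+1]; the difference of the quotients is
   the multiplier. *)
exists ((Num.floor a %/ L.+1)%Z - (Num.floor c %/ L.+1)%Z).
set n := (_ - _ : int).
have fE : Num.floor a = Num.floor c + n * L.+1%:Z.
  by rewrite {1}(divz_eq (Num.floor a) L.+1) {1}(divz_eq (Num.floor c) L.+1) modE /n; ring.
clearbody n.
have /andP[] := floor_itv a; have /andP[] := floor_itv c.
rewrite fE !rmorphD /= rmorphM /= -[(L.+1%:Z)%:~R]/(L.+1%:R : rat).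
rewrite -[X in X * `|_|]ger0_norm // -normrM ltr_norml !mulrBr -/a -/c mulr1z.
by move=> *; apply/andP; split; lra.
Qed.

End Colouring.

(** * Partition regularity and constant solutions *)

Lemma character_sum (V : zmodType) (f : V -> rat) (l : nat) (x : 'I_l -> V) :
    (forall x y, f (x + y) - (f x + f y) \is a Num.int) ->
  f (\sum_j x j) - \sum_j f (x j) \is a Num.int.
Proof.
move=> fD; elim/big_rec2: _ => [|j y s _ IH].
  by have := fD 0 0; rewrite addr0 opprD addrA subrr sub0r rpredN subr0.
have := rpredD (fD (x j) s) IH.
by congr (_ \is a Num.int); ring.
Qed.

Theorem partition_regular_iff_constant (R : comNzRingType) (M : lmodType R) :
  PR_iff_constant M.
Proof.
move=> k l A b [i0 bi0]; split=> [PR|[m mP]]; last first.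
  move=> r _ chi; exists (fun=> m); split=> //.
  have m_neq0 : m != 0.
    apply: contra_neq bi0 => m0; rewrite -mP m0 big1 // => j _; exact: scaler0.
  case: l A mP => [|l] A mP; last by exists ord0.
  by move: bi0; rewrite -mP big_ord0 eqxx.
apply: boolp.contrapT => noconst.
pose V := {ffun 'I_k -> M}.
pose col (j : 'I_l) (x : M) : V := [ffun i => A i j *: x].
pose S (v : V) := exists m, v = \sum_j col j m.
pose b' : V := [ffun i => b i].
have [||[m bE]|f [fD fS fb]] := @separating_character V S b'.
- exists 0; rewrite big1 // => j _; apply/ffunP=> i; rewrite !ffunE; exact: scaler0.
- move=> _ _ [m ->] [m' ->]; exists (m - m'); rewrite -sumrB.
  by apply: eq_bigr => j _; apply/ffunP=> i; rewrite !ffunE scalerBr.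
- apply: noconst; exists m => i; move/ffunP/(_ i): bE; rewrite sum_ffunE !ffunE => ->.
  by apply: eq_bigr => j _; rewrite ffunE.
(* The [l] errors will add up to at most [l / (L.+1)]. Multiplied by the denominator [q], this stays
   below 1 when [L = q * l]. *)
pose q := `|denq (f b')|%N.
pose L := (q * l)%N.
pose C := {ffun 'I_l -> 'I_L.+1}.
have C_gt0 : (0 < #|{: C}|)%N by apply/card_gt0P; exists [ffun=> ord0].
pose phi := approximation M l (fun j x => f (col j x)) L.
have [m [mP [j0 _] mono]] := PR _ C_gt0 (fun x => enum_rank (phi x)).
have close j := approximationP _ _ _ _ _ _ j (enum_rank_inj (mono j j0)).
have [n nP] := boolp.choice close.
pose e j := f (col j (m j)) - f (col j (m j0)) - (n j)%:~R.
pose t := \sum_j e j.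
have tfb : f b' - t \is a Num.int.
  have bE : b' = \sum_j col j (m j).
    apply/ffunP=> i; rewrite sum_ffunE ffunE -mP.
    by apply: eq_bigr => j _; rewrite ffunE.
  have h1 : f b' - \sum_j f (col j (m j)) \is a Num.int.
    by rewrite bE; apply: character_sum.
  have h2 := character_sum _ f _ (fun j => col j (m j0)) fD.
  have h3 : f (\sum_j col j (m j0)) \is a Num.int by apply: fS; exists (m j0).
  have h4 : \sum_j (n j)%:~R \is a @Num.int rat.
    by apply: rpred_sum => j _; apply: intr_int.
  have -> : f b' - t = (f b' - \sum_j f (col j (m j)))
     - (f (\sum_j col j (m j0)) - \sum_j f (col j (m j0)))
     + f (\sum_j col j (m j0)) + \sum_j (n j)%:~R.
    by rewrite /t /e !sumrB; ring.
  by rewrite rpredD // rpredD // rpredB.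
have qE : q%:R = (denq (f b'))%:~R :> rat by rewrite -absz_denq.
have qtint : q%:R * t \is a Num.int.
  rewrite -[t](subKr (f b')) mulrBr rpredB //; last by rewrite rpredM ?natr_int.
  by rewrite qE mulrC -numqE intr_int.
have qt_small : `|q%:R * t| < 1.
  have : L.+1%:R * `|t| <= l%:R.
    apply: le_trans (ler_wpM2l (ler0n _ _) (ler_norm_sum _ _ _)) _.
    rewrite mulr_sumr -[X in _ <= X%:R]card_ord -sumr_const.
    by apply: ler_sum => j _; apply: ltW; apply: nP.
  have q_gt0 : (0 < q)%N by rewrite absz_gt0 denq_neq0.
  rewrite normrM normr_nat => tl.
  rewrite -(@ltr_pM2l _ L.+1%:R) ?ltr0n // mulr1 mulrCA.
  apply: le_lt_trans (ler_wpM2l (ler0n _ _) tl) _.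
  by rewrite -natrM ltr_nat.
(* The integer [q * t] has absolute value below 1, so it vanishes; then [f b'] would be an
   integer. *)
have t0 : t = 0.
  move/intrP: qtint qt_small => [z zE]; rewrite zE -intr_norm ltrz1.
  rewrite -[1]add0r ltzD1 normr_le0 => /eqP z0.
  move/eqP: zE; rewrite z0 mulf_eq0 qE intr_eq0 denq_eq0 => /eqP //.
by move: fb; rewrite -[f b']subr0 -t0 tfb.
Qed.

Theorem theorem5p10 :
  (* (a) integral domain, torsion-free module *)
  (forall (R : idomainType) (M : lmodType R), torsion_free M -> PR_iff_constant M)
  /\
  (* (b) Dedekind domain, arbitrary module *)
  (forall (R : idomainType), dedekind_domain R ->
     forall M : lmodType R, PR_iff_constant M)
  /\
  (* (c) reduced ring with finitely many minimal primes, M = R *)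
  (forall (R : comNzRingType), reduced_ring R -> finitely_many_minimal_primes R ->
     PR_iff_constant R^o).
Proof.
by split; [|split] => *; apply: partition_regular_iff_constant.
Qed.
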